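(* Let $C>0$ and let $(X,d,\nu)$ be a compact measured length space that satisfies $\mathrm{DM}(C)$, and suppose that $\nu$ is doubling with doubling constant $D$. Then $(X,d,\nu)$ admits a local Poincaré inequality with $\lambda=2$ and $P=2CD$; that is, for all $u\in C(X)$, all balls $B=B_r(x)$ with $\nu[B]>0$ and each upper gradient $g$ of $u$, $$\frac{1}{\nu[B]}\int_B |u-\langle u\rangle_B|\,d\nu\ \le\ 2CD\, r\,\frac{1}{\nu[2B]}\int_{2B} g\,d\nu .$$
   Context: A compact measured length space $(X,d,\nu)$ is a compact length space $(X,d)$ equipped with a Borel probability measure $\nu$. Balls are $B_r(x)=\{y\in X: d(x,y)<r\}$, and for $B=B_r(x)$, $\lambda B$ denotes $B_{\lambda r}(x)$. $\langle u\rangle_B=\frac1{\nu[B]}\int_B u\,d\nu$. $\Gamma$ is the set of minimizing constant-speed geodesics $\gamma:[0,1]\to X$, $e_t(\gamma)=\gamma(t)$, $E=(e_0,e_1):\Gamma\to X\times X$. For $\mu\in P(X)$ a dynamical democratic transference plan from $\mu$ to itself is $\Pi\in P(\Gamma)$ with $E_*\Pi=\mu\otimes\mu$. $(X,d,\nu)$ satisfies $\mathrm{DM}(C)$ if for each ball $B\subset X$ with $\nu[B]>0$ there is a dynamical democratic transference plan $\Pi$ from $\mu=\frac{1_B}{\nu[B]}\nu$ to itself such that, with $\mu_t=(e_t)_*\Pi$, $\int_0^1\mu_t\,dt\le\frac{C}{\nu[B]}\nu$ as measures. $\nu$ is doubling with doubling constant $D>0$ if $\nu[2B]\le D\,\nu[B]$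 for all balls $B$. An upper gradient of $u\in C(X)$ is a Borel function $g:X\to[0,\infty]$ such that for each curve $\gamma:[0,1]\to X$ with finite length $L(\gamma)$ and constant speed, $|u(\gamma(1))-u(\gamma(0))|\le L(\gamma)\int_0^1 g(\gamma(t))\,dt$. *)

(* Defs.v *)
From HB Require Import structures.
From mathcomp Require Import all_boot all_order all_algebra.
From mathcomp Require Import all_classical all_reals all_analysis.
From mathcomp Require Import measurable_realfun.

Set Implicit Arguments.
Unset Strict Implicit.
Unset Printing Implicit Defensive.

Import Order.TTheory GRing.Theory Num.Theory.
Import numFieldNormedType.Exports.

Local Open Scope classical_set_scope.
Local Open Scope ring_scope.

(* The library's measurable types are pointed, hence the pointed variant of
   [metricType]; a space that carries a probability measure is nonempty. *)
#[short(type="pmetricType")]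
HB.structure Definition PointedMetric (K : numDomainType) :=
  { M of Metric K M & isPointed M }.

Notation borel T := (g_sigma_algebraType (@open T)).

Lemma borel_measurable_ball (R : realType) (X : pmetricType R) (x : X) (r : R) :
  measurable (ball x r : set (borel X)).
Proof.
apply: sub_sigma_algebra; rewrite /= openE => y.
rewrite ballEmdist /interior -nbhs_ballE /= => xy.
exists (r - mdist x y) => /=; first by rewrite subr_gt0.
move=> z; rewrite ballEmdist /= => yz.
by rewrite (le_lt_trans (metric_triangle _ y _)) // -ltrBrDl.
Qed.

Notation I01 R := (set_type [set` `[0 : R, 1]]).

Section unit_interval.
Context {R : realType}.

Lemma I01_clamp_subproof (t : R) :
  Num.max 0 (Num.min t 1) \in [set` `[0 : R, 1]].
Proof.
by apply/mem_set; rewrite /= in_itv /= le_max lexx /= ge_max ler01 ge_min lexx orbT.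
Qed.

(* The retraction of R onto [0, 1]. *)
Definition clamp (t : R) : I01 R :=
  exist _ (Num.max 0 (Num.min t 1)) (I01_clamp_subproof t).

Definition zero01 : I01 R := clamp 0.
Definition one01 : I01 R := clamp 1.

End unit_interval.

Section curves.
Context {R : realType} {X : metricType R}.
Implicit Type gam : I01 R -> X.

(* Length of the restriction of [gam] to [a, b], as the supremum over the
   subdivisions a = t 0 <= t 1 <= ... <= t n = b. *)
Definition length_on gam (a b : I01 R) : \bar R :=
  ereal_sup [set l | exists n (t : nat -> I01 R),
    [/\ t 0%N = a, t n = b,
        forall i, (i < n)%N -> \val (t i) <= \val (t i.+1) &
        l = (\sum_(i < n) mdist (gam (t i)) (gam (t i.+1)))%:E] ].

Definition curve_length gam : \bar R := length_on gam zero01 one01.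

Definition constant_speed gam : Prop := forall a b : I01 R,
  \val a <= \val b ->
  length_on gam a b = ((\val b - \val a)%:E * curve_length gam)%E.

Definition minimizing_geodesic gam : Prop :=
  [/\ continuous gam, constant_speed gam &
      curve_length gam = (mdist (gam zero01) (gam one01))%:E].

Lemma minimizing_geodesic_cst (x : X) : minimizing_geodesic (cst x).
Proof.
have length0 a b : \val a <= \val b -> length_on (cst x) a b = 0%E.
  move=> ab; rewrite /length_on.
  suff -> : [set l | exists n (t : nat -> I01 R),
    [/\ t 0%N = a, t n = b,
        forall i, (i < n)%N -> \val (t i) <= \val (t i.+1) &
        l = (\sum_(i < n) mdist (cst x (t i)) (cst x (t i.+1)))%:E] ] = [set 0%E].
    by rewrite ereal_sup1.
  apply/seteqP; split => [l [n [t [_ _ _ ->]]]|l -> ] /=.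
    by rewrite big1 // => i _; rewrite mdistxx.
  exists 1%N, (fun i => if i is 0%N then a else b); split => //.
    by case.
  by rewrite big_ord1 mdistxx.
have le01 : \val (@zero01 R) <= \val (@one01 R).
  have clampE (t : R) : 0 <= t <= 1 -> \val (clamp t) = t.
    by case/andP=> t0 t1; rewrite /= (min_idPl t1) (max_idPr t0).
  by rewrite !clampE ?lexx ?ler01.
split; first exact: cst_continuous.
- by move=> a b ab; rewrite /curve_length !length0 // mule0.
- by rewrite /curve_length length0 // mdistxx.
Qed.

End curves.

Definition is_length_space (R : realType) (X : metricType R) : Prop :=
  forall x y : X, (mdist x y)%:E =
    ereal_inf [set l | exists gam : I01 R -> X,
      [/\ continuous gam, gam zero01 = x, gam one01 = y &
          l = curve_length gam] ].

(* The space Gamma of geodesics, with the topology of uniform convergence. *)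
Definition geodesics (R : realType) (X : metricType R) :
    set (arrow_uniform_type (I01 R) X) :=
  [set gam | minimizing_geodesic gam].

Definition geodesic (R : realType) (X : metricType R) : Type :=
  set_type (@geodesics R X).

HB.instance Definition _ (R : realType) (X : metricType R) :=
  Topological.on (geodesic X).

HB.instance Definition _ (R : realType) (X : pmetricType R) :=
  isPointed.Build (geodesic X)
    (exist _ (cst point) (mem_set (minimizing_geodesic_cst (point : X)))).

Section democratic.
Context {R : realType} {X : pmetricType R}.

Definition ev (t : I01 R) (gam : borel (geodesic X)) : borel X := \val gam t.

Definition endpoints (gam : borel (geodesic X)) : borel X * borel X :=
  (ev zero01 gam, ev one01 gam).

(* The measure 1_B / nu[B] nu with B = ball x r; the second argument of
   [mnormalize] is only used when nu[B] = 0. *)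
Definition uniform_on_ball (nu : probability (borel X) R) (x : X) (r : R) :
    probability (borel X) R :=
  mnormalize (mrestr nu (borel_measurable_ball x r)) nu.

Definition democratic_plan (mu : probability (borel X) R)
    (Pi : probability (borel (geodesic X)) R) : Prop :=
  forall A : set (borel X * borel X), measurable A ->
    pushforward Pi endpoints A = (mu \x mu)%E A.

Definition DM (nu : probability (borel X) R) (C : R) : Prop :=
  forall (x : X) (r : R), (0 < nu (ball x r))%E ->
  exists Pi : probability (borel (geodesic X)) R,
    democratic_plan (uniform_on_ball nu x r) Pi /\
    forall A : set (borel X), measurable A ->
      (\int[lebesgue_measure]_(t in `[0%R, 1%R])
          pushforward Pi (ev (clamp t)) A
        <= C%:E / nu (ball x r) * nu A)%E.

Definition doubling (nu : probability (borel X) R) (D : R) : Prop :=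
  forall (x : X) (r : R), (nu (ball x (2 * r)) <= D%:E * nu (ball x r))%E.

Definition upper_gradient (u : X -> R) (g : borel X -> \bar R) : Prop :=
  [/\ measurable_fun [set: borel X] g, forall x, (0 <= g x)%E &
      forall gam : I01 R -> X, continuous gam -> constant_speed gam ->
        (curve_length gam < +oo)%E ->
        (`|u (gam one01) - u (gam zero01)|%:E <=
          curve_length gam *
          \int[lebesgue_measure]_(t in `[0%R, 1%R]) g (gam (clamp t)))%E].

Definition average (nu : probability (borel X) R) (B : set (borel X))
    (f : borel X -> \bar R) : \bar R :=
  ((\int[nu]_(y in B) f y) / nu B)%E.

Definition local_Poincare (nu : probability (borel X) R) (lambda P : R) : Prop :=
  forall u : X -> R, continuous u ->
  forall (x : X) (r : R), (0 < nu (ball x r))%E ->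
  forall g : borel X -> \bar R, upper_gradient u g ->
  let m := fine (average nu (ball x r) (fun y => (u y)%:E)) in
  (average nu (ball x r) (fun y => `|u y - m|%:E) <=
    (P * r)%:E * average nu (ball x (lambda * r)) g)%E.

End democratic.

(* Main.v *)
Require Import Defs.
From mathcomp Require Import all_boot all_order all_algebra.
From mathcomp Require Import all_classical all_reals all_analysis.
From mathcomp Require Import measurable_realfun.
From mathcomp Require Import ring lra.

Import Order.TTheory GRing.Theory Num.Theory.
Import numFieldNormedType.Exports.

Local Open Scope classical_set_scope.
Local Open Scope ring_scope.

(** The proof follows the mass of the ball B = B_r(x) as it is transported onto
    itself.  Let mu be the uniform probability on B.  Jensen's inequality bounds
    the mean oscillation of u on B by the double integral of |u(y) - u(z)| with
    respect to mu x mu ([mean_oscillation_le]), and the democratic plan Pi turns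
    this into the integral over geodesics gamma of |u(gamma 0) - u(gamma 1)|.

    Almost every gamma has both endpoints in B, hence is shorter than 2r and
    stays inside 2B ([geodesic_ball]).  Since g is an upper gradient, the
    integrand is then at most 2r times the time integral of g 1_{2B} along
    gamma.  By Tonelli's theorem the integral of the latter over gamma is the
    integral of g 1_{2B} against the occupation measure of Pi, which DM(C)
    bounds by (C / nu[B]) nu ([le_occupation]).  Doubling replaces 1 / nu[B] by
    D / nu[2B], and the product of the constants is 2 C D r.

    The delicate point is measurability: Tonelli's theorem requires
    (t, gamma) |-> gamma(t) to be measurable for the product of the Borel
    sigma-algebras.  The map is jointly continuous for uniform convergence
    ([ev_joint_continuous]), and the open sets of a product R x Y are measurable
    for the product sigma-algebra whatever Y is, because R has a countable basis
    ([open_measurable_prod]). *)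

(** * Geodesics between points of a ball *)

Section geodesics.
Set Implicit Arguments.
Unset Strict Implicit.
Context {R : realType} {X : metricType R}.
Implicit Type gam : I01 R -> X.

Lemma mdist_le_length_on gam (a b : I01 R) : \val a <= \val b ->
  ((mdist (gam a) (gam b))%:E <= length_on gam a b)%E.
Proof.
move=> ab; apply: ereal_sup_ubound; exists 1%N, (fun i => if i is 0%N then a else b).
by split => //; [case|rewrite big_ord1].
Qed.

Lemma val_zero01 : \val (@zero01 R) = 0.
Proof. by rewrite /= (min_idPl ler01) maxxx. Qed.

Lemma val_one01 : \val (@one01 R) = 1.
Proof. by rewrite /= minxx (max_idPr ler01). Qed.

Lemma I01_itv (t : I01 R) : 0 <= \val t <= 1.
Proof. by have /set_mem := valP t; rewrite /= in_itv. Qed.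

Lemma geodesic_dist gam (a b : I01 R) : minimizing_geodesic gam ->
  \val a <= \val b ->
  mdist (gam a) (gam b) <= (\val b - \val a) * mdist (gam zero01) (gam one01).
Proof.
move=> [_ cs len] ab; rewrite -lee_fin EFinM -len -cs//.
exact: mdist_le_length_on.
Qed.

(** The point [gam t] is within half the length of [gam] of one of the endpoints,
    and this length is less than 2r; the nearer endpoint depends on whether t is
    at most 1/2, which is why both triangle inequalities are used. *)
Lemma geodesic_ball gam (x : X) (r : R) (t : I01 R) : minimizing_geodesic gam ->
  ball x r (gam zero01) -> ball x r (gam one01) -> ball x (2 * r) (gam t).
Proof.
move=> geo; rewrite !ballEmdist /= => x0 x1.
have /andP[t0 t1] := I01_itv t.
have := geodesic_dist geo (_ : \val zero01 <= \val t).
rewrite val_zero01 subr0 => /(_ t0) d0.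
have := geodesic_dist geo (_ : \val t <= \val one01).
rewrite val_one01 => /(_ t1) d1.
have T0 := metric_triangle x (gam zero01) (gam t).
have T1 := metric_triangle x (gam one01) (gam t).
rewrite (metric_sym (gam one01)) in T1.
have L := metric_triangle (gam zero01) x (gam one01).
rewrite (metric_sym (gam zero01) x) in L.
set l := mdist (gam zero01) (gam one01) in d0 d1 L.
have l0 : 0 <= l by exact: mdist_ge0.
set v := \val t in t0 t1 d0 d1 *.
have [th|th] := leP v (1 / 2).
  have : v * l <= (1/2) * l by rewrite ler_wpM2r.
  by lra.
have : (1 - v) * l <= (1/2) * l by rewrite ler_wpM2r//; lra.
lra.
Qed.

End geodesics.

(** * Measurability of evaluation along geodesics *)

Section occupation.
Set Implicit Arguments.
Unset Strict Implicit.
Context {R : realType}.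

(** Only the factor R needs a countable basis: an open W is the union over the
    rational intervals ]a, b[ of ]a, b[ x O(a, b), where O(a, b) is the interior
    of the set of the y with ]a, b[ x {y} included in W. *)
Lemma open_measurable_prod (Y : ptopologicalType) (W : set (R * Y)) :
  open W -> measurable (W : set (R * borel Y)).
Proof.
move=> oW.
pose O (ab : rat * rat) : set Y :=
  interior [set y | forall t, t \in `]ratr ab.1, ratr ab.2[ -> W (t, y)].
have -> : W = \bigcup_(ab in [set: rat * rat])
    ([set` `]ratr ab.1, ratr ab.2[] `*` O ab).
  apply/seteqP; split=> [[t y] Wty|[t y] [ab _ /= [tab /interior_subset]]]; last exact.
  have /= [[A B] /= [At By] AB] : nbhs (t, y) W.
    by move: oW; rewrite openE; exact.
  have [e /= e0 eA] := At.
  have /rat_in_itvoo[a /itvP aP] : t - e < t by rewrite ltrBlDr ltrDl.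
  have /rat_in_itvoo[b /itvP bP] : t < t + e by rewrite ltrDl.
  exists (a, b) => //; split => /=; first by rewrite in_itv /= aP bP.
  apply: filterS By => z Bz /= s /itvP sab; apply: AB; split => //=.
  apply: eA; rewrite /= ltr_norml.
  have h1 : t - e < ratr a by rewrite aP.
  have h2 : ratr b < t + e by rewrite bP.
  have h3 : ratr a < s by rewrite sab.
  have h4 : s < ratr b by rewrite sab.
  apply/andP; split; lra.
apply: countable_bigcupT_measurable => [|ab]; first exact: countableP.
apply: measurableX; first exact: measurable_itv.
by apply: sub_sigma_algebra; exact: open_interior.
Qed.

Lemma continuous_borel_measurable (Y : ptopologicalType) (f : Y -> R) :
  continuous f -> measurable_fun [set: borel Y] f.
Proof.
move=> cf; apply: (measurability _ (@RGenOpens.measurableE R)).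
move=> _ [_ [a [b ->]] <-]; rewrite setTI; apply: sub_sigma_algebra.
by apply: open_comp; [move=> y _; exact: cf | exact: interval_open].
Qed.

Lemma clamp_continuous : continuous (@clamp R).
Proof.
apply: continuous_comp_initial => t.
have /= := @continuous_max R R (cst 0) (fun t : R => Num.min t 1) t.
apply; first exact: cvg_cst.
apply: (@continuous_min R R id (cst 1)); [exact: cvg_id|exact: cvg_cst].
Qed.

(** Uniform convergence is what makes the pairing continuous:
    d(g0 t0, g t) <= d(g0 t0, g0 t) + d(g0 t, g t), and the last term is small
    uniformly in t. *)
Lemma ev_joint_continuous (X : pmetricType R) :
  continuous (fun p : R * geodesic X => \val p.2 (clamp p.1) : X).
Proof.
move=> [t0 g0]; apply/cvg_ballP => e e0.
have [cg _ _] : minimizing_geodesic (\val g0) by exact: (set_mem (valP g0)).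
have e2 : 0 < e / 2 by rewrite divr_gt0.
have H1 : nbhs t0 [set t | ball (\val g0 (clamp t0)) (e / 2) (\val g0 (clamp t))].
  have := @continuous_comp _ _ _ (@clamp R) (\val g0) t0 (@clamp_continuous t0) (cg _).
  by move/cvg_ballP => /(_ _ e2).
have H2 : nbhs g0 [set g : geodesic X | forall t, ball (\val g0 t) (e / 2) (\val g t)].
  have := @initial_continuous _ _ (@set_val _ (@geodesics R X)) g0.
  move/(@cvg_ballP R) => /(_ _ e2).
  exact.
exists ([set t | ball (\val g0 (clamp t0)) (e / 2) (\val g0 (clamp t))],
  [set g : geodesic X | forall t, ball (\val g0 t) (e / 2) (\val g t)]) => //.
move=> [t g] /= [h1 h2].
rewrite (splitr e); exact: ball_triangle h1 (h2 _).
Qed.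

Context {X : pmetricType R}.

Lemma measurable_ev_joint :
  measurable_fun [set: R * borel (geodesic X)]
    (fun p : R * borel (geodesic X) => ev (clamp p.1) p.2).
Proof.
apply: measurability; first by [].
move=> _ [U oU <-]; rewrite setTI; apply: open_measurable_prod.
apply: open_comp => // p _; exact: ev_joint_continuous.
Qed.

Lemma measurable_ev (t : R) :
  measurable_fun [set: borel (geodesic X)] (@ev R X (clamp t)).
Proof. exact: (measurableT_comp measurable_ev_joint (measurable_pair1 t)). Qed.

Lemma measurable_geodesic (gam : borel (geodesic X)) :
  measurable_fun [set: R] (fun t : R => ev (clamp t) gam : borel X).
Proof. exact: (measurableT_comp measurable_ev_joint (measurable_pair2 gam)). Qed.

Lemma measurable_endpoints :
  measurable_fun [set: borel (geodesic X)] (@endpoints R X).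
Proof. by apply/measurable_fun_pairP; split; exact: measurable_ev. Qed.

Local Open Scope ereal_scope.

(** Time averages are written as integrals against a probability on R, so that
    Tonelli's theorem and product measures apply without restricting the time
    variable to [0, 1]. *)
Lemma integral_uniform01 (f : R -> \bar R) : measurable_fun setT f ->
  (forall t, 0 <= f t) ->
  \int[uniform_prob (@ltr01 R)]_t f t =
  \int[lebesgue_measure]_(t in `[0%R, 1%R]) f t.
Proof. by move=> mf f0; rewrite integral_uniform// subr0 invr1 mul1e. Qed.

(** The measure A |-> \int_0^1 Pi(gam t in A) dt is the image of the product of
    the uniform law of t with Pi under the joint evaluation, so that
    bounding this measure on sets bounds its integrals of nonnegative functions. *)
Lemma le_occupation (Pi : probability (borel (geodesic X)) R)
    (nu : probability (borel X) R) (c : R) (h : borel X -> \bar R) :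
  (0 <= c)%R ->
  (forall A : set (borel X), measurable A ->
      \int[lebesgue_measure]_(t in `[0%R, 1%R]) pushforward Pi (ev (clamp t)) A
        <= c%:E * nu A) ->
  measurable_fun setT h -> (forall x, 0 <= h x) ->
  \int[Pi]_gam \int[lebesgue_measure]_(t in `[0%R, 1%R]) h (ev (clamp t) gam)
  <= c%:E * \int[nu]_x h x.
Proof.
move=> c0 occ mh h0.
set U := uniform_prob (@ltr01 R).
pose e (p : R * borel (geodesic X)) := ev (clamp p.1) p.2.
have me : measurable_fun setT e by exact: measurable_ev_joint.
have mhe : measurable_fun setT (h \o e) by exact: measurableT_comp.
have -> : \int[Pi]_gam \int[lebesgue_measure]_(t in `[0%R, 1%R])
    h (ev (clamp t) gam) = \int[U \x Pi]_p (h \o e) p.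
  rewrite fubini_tonelli2//; last by move=> p; exact: h0.
  apply: eq_integral => gam _; rewrite /fubini_G integral_uniform01//.
    exact: (measurableT_comp mh (measurable_geodesic gam)).
  by move=> t; exact: h0.
have -> : c%:E * \int[nu]_x h x = \int[mscale (NngNum c0) nu]_x h x.
  by rewrite ge0_integral_mscale.
have -> : \int[U \x Pi]_p (h \o e) p = \int[pushforward (U \x Pi) e]_x h x.
  by rewrite ge0_integral_pushforward//= preimage_setT.
apply: (@ge0_le_measure_integral _ _ _
  (measure_function_pushforward__canonical__measure_function_Measure (U \x Pi) me)) => //.
move=> A mA; apply: le_trans (occ A mA).
rewrite /= /pushforward /= /product_measure1 integral_uniform01 //.
- rewrite le_eqVlt; apply/orP; left; apply/eqP.
  apply: eq_integral => t _ /=; congr (Pi _).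
  by apply/seteqP; split=> gam; rewrite /xsection /= inE.
- apply: measurable_fun_xsection.
  by rewrite -[X in measurable X]setTI; exact: me.
Qed.

Lemma measurable_occupation_time (h : borel X -> \bar R) :
  measurable_fun setT h -> (forall x, 0 <= h x) ->
  measurable_fun [set: borel (geodesic X)] (fun gam =>
    \int[lebesgue_measure]_(t in `[0%R, 1%R]) h (ev (clamp t) gam)).
Proof.
move=> mh h0.
have mhe : measurable_fun setT (fun p : R * borel (geodesic X) => h (ev (clamp p.1) p.2)).
  exact: (measurableT_comp mh measurable_ev_joint).
rewrite [X in measurable_fun _ X](_ : _ = fubini_G (uniform_prob (@ltr01 R))
    (fun p : R * borel (geodesic X) => h (ev (clamp p.1) p.2))).
  by apply: measurable_fun_fubini_tonelli_G => // p; exact: h0.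
apply/funext => gam; rewrite /fubini_G integral_uniform01//.
exact: (measurableT_comp mh (measurable_geodesic gam)).
Qed.

(** * Oscillation and the uniform probability on a ball *)

Section ball.
Variables (nu : probability (borel X) R) (x : X) (r : R).
Hypothesis nuB : 0 < nu (ball x r).
Let mB := borel_measurable_ball x r.

Lemma uniform_on_ballE (A : set (borel X)) :
  uniform_on_ball nu x r A = (fine (nu (ball x r)))^-1%:E * nu (A `&` ball x r).
Proof.
(* [mnormalize] divides by the mass of the whole space, here nu[B] *)
transitivity (let B := [set: borel X] `&` ball x r in
  (if (nu B == 0) || (nu B == +oo) then fun A => nu A
   else fun A => nu (A `&` ball x r) * (fine (nu B))^-1%:E) A); first by [].
rewrite /= setTI gt_eqF//= lt_eqF; first by rewrite muleC.
by rewrite ltey_eq fin_num_measure.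
Qed.

Lemma uniform_on_ball_self : uniform_on_ball nu x r (ball x r) = 1.
Proof.
have nuBfin : nu (ball x r) \is a fin_num by exact: fin_num_measure.
rewrite uniform_on_ballE setIid -[X in _ * X]fineK// -EFinM mulVf//.
by rewrite gt_eqF// fine_gt0// nuB ltey_eq nuBfin.
Qed.

Lemma integral_uniform_on_ball (f : borel X -> \bar R) :
  measurable_fun setT f -> (forall y, 0 <= f y) ->
  \int[uniform_on_ball nu x r]_y f y = average nu (ball x r) f.
Proof.
move=> mf f0.
have nuBfin : nu (ball x r) \is a fin_num by exact: fin_num_measure.
have b0 : (0 < fine (nu (ball x r)))%R by rewrite fine_gt0// nuB ltey_eq nuBfin.
rewrite (@ge0_negligible_integral _ _ _ _ _ (~` (ball x r : set (borel X))))//; last 2 first.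
- exact: measurableC.
- by rewrite [LHS]uniform_on_ballE setICl measure0 mule0.
rewrite setTD setCK.
have ib0 : (0 <= (fine (nu (ball x r)))^-1)%R by rewrite invr_ge0 ltW.
rewrite (@eq_measure_integral _ _ _ _ (mscale (NngNum ib0) nu)).
  rewrite ge0_integral_mscale//; last exact: measurable_funTS.
  by rewrite /average muleC -[X in _ / X]fineK// inver gt_eqF.
by move=> A mA AB; rewrite [LHS]uniform_on_ballE setIidl.
Qed.

(** Jensen's inequality, in the form |u(y) - m| = |average of u(y) - u(z) over z|
    <= average of |u(y) - u(z)|.  Compactness of the space makes u bounded, hence
    integrable. *)
Lemma mean_oscillation_le (u : X -> R) : compact [set: X] -> continuous u ->
  let m := fine (average nu (ball x r) (fun y => (u y)%:E)) in
  average nu (ball x r) (fun y => `|u y - m|%:E) <=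
  \int[uniform_on_ball nu x r \x uniform_on_ball nu x r]_p `|u p.1 - u p.2|%:E.
Proof.
move=> cX cu /=; set m := fine (average _ _ _).
have mu : measurable_fun [set: borel X] u by exact: continuous_borel_measurable.
have mu2 : measurable_fun [set: borel X * borel X] (fun p => `|u p.1 - u p.2|%:E).
  apply/measurable_EFinP; apply: measurableT_comp => //.
  by apply: measurable_funB; apply: measurableT_comp.
have nuBfin : nu (ball x r) \is a fin_num by exact: fin_num_measure.
have b0 : (0 < fine (nu (ball x r)))%R by rewrite fine_gt0// nuB ltey_eq nuBfin.
set b := fine _ in b0.
have bE : nu (ball x r) = b%:E by rewrite /b fineK.
rewrite fubini_tonelli1//.
rewrite -integral_uniform_on_ball//; last first.
  apply/measurable_EFinP; apply: measurableT_comp => //; exact: measurable_funB.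
apply: ge0_le_integral => //.
- apply/measurable_EFinP; apply: measurableT_comp => //; exact: measurable_funB.
- by apply: measurable_fun_fubini_tonelli_F => // p; rewrite lee_fin.
move=> y _; rewrite /fubini_F [leRHS]integral_uniform_on_ball//=; last first.
  apply/measurable_EFinP; apply: measurableT_comp => //; exact: measurable_funB.
have iu : nu.-integrable (ball x r) (EFin \o u).
  apply: measurable_bounded_integrable => //.
  - by rewrite ltey_eq nuBfin.
  - exact: measurable_funTS.
  - have [M [Mr uM]] := compact_bounded
      (continuous_compact (continuous_subspaceT cu) cX).
    by exists M; split=> // N MN y' _; apply: uM MN _ _; exists y'.
have muE : m%:E = (\int[nu]_(z in ball x r) (u z)%:E) * b^-1%:E.
  rewrite /m /average bE inver gt_eqF// fineK// fin_numM//.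
  exact: integrable_fin_num.
have -> : `|u y - m|%:E =
    `|\int[nu]_(z in ball x r) (u y - u z)%:E| * b^-1%:E.
  rewrite [X in `|X|](_ : _ = (u y)%:E * b%:E - \int[nu]_(z in ball x r) (u z)%:E).
    move: muE; rewrite -[X in X * _]fineK; last exact: integrable_fin_num.
    move=> [->]; rewrite -[X in _ - X]fineK; last exact: integrable_fin_num.
    set i := fine _; change (`|u y - i / b|%:E = (`|u y * b - i| / b)%:E); congr EFin.
    have -> : (u y - i / b = (u y * b - i) / b)%R by field; rewrite gt_eqF.
    by rewrite normrM [X in (_ * X)%R]gtr0_norm// invr_gt0.
  rewrite -bE -integral_cst//.
  apply: (@integralB_EFin _ _ _ nu _ (cst (u y)) (u : borel X -> R) mB _ iu).
  exact: finite_measure_integrable_cst.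
rewrite /average bE inver gt_eqF// lee_wpmul2r//.
  by rewrite lee_fin invr_ge0 ltW.
apply: (le_trans (le_abse_integral _ _ _)) => //.
by apply/measurable_EFinP/measurable_funTS/measurable_funB.
Qed.

End ball.
End occupation.

(** * The local Poincare inequality *)

Theorem theorem2p5 (R : realType) (X : pmetricType R)
    (nu : probability (borel X) R) (C D : R) :
  0 < C -> 0 < D ->
  compact [set: X] -> is_length_space X ->
  DM nu C -> doubling nu D ->
  local_Poincare nu 2 (2 * C * D).
Proof.
move=> C0 D0 cX _ dm dbl u cu x r nuB g [mg g0 ug] /=.
have mB := borel_measurable_ball x r.
have mB2 := borel_measurable_ball x (2 * r).
pose B : set (borel X) := ball x r.
pose B2 : set (borel X) := ball x (2 * r).
have r0 : 0 < r.
  rewrite ltNge; apply/negP => r0; move: nuB; rewrite (_ : ball x r = set0).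
    by rewrite measure0 ltxx.
  apply/seteqP; split=> // y; rewrite ballEmdist /= => /lt_le_trans/(_ r0).
  by rewrite ltNge mdist_ge0.
have [Pi [demo occ]] := dm x r nuB.
set mu := uniform_on_ball nu x r in demo.
pose h : borel X -> \bar R := g \_ B2.
have mh : measurable_fun setT h.
  by apply/(measurable_restrictT _ _).1 => //; exact: measurable_funTS.
have h0 y : (0 <= h y)%E by apply: erestrict_ge0.
pose F (p : borel X * borel X) : \bar R := `|u p.1 - u p.2|%:E.
have mF : measurable_fun setT F.
  apply/measurable_EFinP; apply: measurableT_comp => //.
  by apply: measurable_funB; apply: measurableT_comp (continuous_borel_measurable cu) _.
have F0 p : (0 <= F p)%E by rewrite lee_fin.
pose J (gam : borel (geodesic X)) : \bar R :=
  (\int[lebesgue_measure]_(t in `[0%R, 1%R]) h (ev (clamp t) gam))%E.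
have J0 gam : (0 <= J gam)%E by exact: integral_ge0.
have mJ : measurable_fun setT J by exact: measurable_occupation_time.
apply: (le_trans (mean_oscillation_le nuB cX cu)).
have -> : (\int[mu \x mu]_p F p = \int[Pi]_gam F (endpoints gam))%E.
  transitivity (\int[pushforward Pi (@endpoints R X)]_p F p)%E.
    apply: (@eq_measure_integral _ _ _ _
      (measure_function_pushforward__canonical__measure_function_Measure
        Pi (@measurable_endpoints R X))) => A mA _.
    by rewrite [LHS]/= -demo.
  rewrite ge0_integral_pushforward//= ?preimage_setT//.
  exact: measurable_endpoints.
(* the speed of [gam] is d(gam 0, gam 1) <= 2r, and [g] agrees with its
   truncation [h] to 2B along [gam] *)
have key (gam : borel (geodesic X)) : B (ev zero01 gam) -> B (ev one01 gam) ->
    (F (endpoints gam) <= (2 * r)%:E * J gam)%E.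
  move=> B0 B1.
  have geo : minimizing_geodesic (\val gam) by exact: (set_mem (valP gam)).
  have [cg sg lg] := geo.
  have := ug _ cg sg; rewrite lg ltry => /(_ isT) ugg.
  rewrite /F /= distrC; apply: (le_trans ugg).
  have -> : (\int[lebesgue_measure]_(t in `[0%R, 1%R]) g (\val gam (clamp t)) = J gam)%E.
    apply: eq_integral => t _; rewrite /h patchT//; apply/mem_set.
    exact: geodesic_ball geo B0 B1.
  rewrite lee_wpmul2r// lee_fin.
  move: B0 B1; rewrite /B !ballEmdist /= => B0 B1.
  have := metric_triangle (ev zero01 gam : X) x (ev one01 gam).
  rewrite (metric_sym _ x) /ev => T; lra.
(* the bound holds only off the Pi-null set of geodesics with an endpoint outside B *)
apply: (@le_trans _ _ (\int[Pi]_gam ((2 * r)%:E * J gam))%E).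
  have mBB : measurable (B `*` B) by exact: measurableX.
  have mE : measurable (@endpoints R X @^-1` (B `*` B)).
    by rewrite -[X in measurable X]setTI; exact: measurable_endpoints.
  apply: ae_ge0_le_integral => //.
  - exact: measurableT_comp mF (@measurable_endpoints R X).
  - by move=> gam _; rewrite mule_ge0// lee_fin mulr_ge0// ltW.
  - exact: measurable_funeM.
  exists (~` (@endpoints R X @^-1` (B `*` B))); split.
  - exact: measurableC.
  - have Pi1 : Pi (@endpoints R X @^-1` (B `*` B)) = 1%E.
      have := demo _ mBB; rewrite /pushforward => ->.
      transitivity (mu B * mu B)%E; first exact: product_measure1E.
      by rewrite (_ : mu B = 1%E) ?mule1//; exact: uniform_on_ball_self.
    by have := @probability_setC _ _ _ Pi _ mE; rewrite Pi1 subee.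
  - move=> gam /= nle [B0 B1]; apply: nle => _; exact: key.
rewrite ge0_integralZl//; last by rewrite lee_fin mulr_ge0// ltW.
have nuBfin : nu (ball x r) \is a fin_num by exact: fin_num_measure.
have nuB2fin : nu (ball x (2 * r)) \is a fin_num by exact: fin_num_measure.
have sub : (nu (ball x r) <= nu (ball x (2 * r)))%E.
  apply: le_measure; rewrite ?inE// => y; rewrite !ballEmdist /= => xy.
  lra.
have := dbl x r; move: nuB sub occ.
rewrite -(fineK nuBfin) -(fineK nuB2fin) /average -(fineK nuB2fin).
set b := fine (nu (ball x r)); set b2 := fine (nu (ball x (2 * r))).
rewrite lte_fin -EFinM !lee_fin !inver => b0 bb2 + b2D.
have b20 : 0 < b2 by exact: lt_le_trans bb2.
rewrite !gt_eqF// -EFinM => occ.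
have cb0 : 0 <= C / b by rewrite divr_ge0// ltW.
apply: (@le_trans _ _ ((2 * r)%:E * ((C / b)%:E * \int[nu]_y h y))%E).
  by rewrite lee_wpmul2l ?lee_fin ?mulr_ge0 ?(ltW r0)//; exact: le_occupation.
rewrite -integral_mkcond [X in (_ <= _ * X)%E]muleC !muleA -!EFinM lee_wpmul2r//.
  exact: integral_ge0.
rewrite lee_fin -!mulrA !ler_pM2l// mulrCA ler_pM2l//.
rewrite mulrCA ler_pM2l// ler_pdivlMr// mulrC ler_pdivrMr//.
Qed.
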